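(* Let $G$ be a bicyclic graph with minimum degree $\delta(G)=1$. Then $G$ has exactly two main signless Laplacian eigenvalues if and only if $G$ is isomorphic to a graph $H$ of the following form, for some integer $k\geq 2$: take two distinct vertices $u,v$; join them by three internally vertex-disjoint paths, namely two paths $u\,p\,v$ and $u\,q\,v$ of length $2$, and one path $u\,x_1x_2\cdots x_{k-1}\,v$ of length $k$; finally attach exactly one new pendant vertex $y_i$ (adjacent only to $x_i$) to each internal vertex $x_i$, $1\le i\le k-1$, of the path of length $k$.
   Context: All graphs are finite, simple and connected. A bicyclic graph is a simple connected graph whose number of edges equals its number of vertices plus one. For a graph $G$ with degree matrix $D=\mathrm{diag}(d(v_1),\dots,d(v_n))$ and adjacency matrix $A$, the signless Laplacian is $L^+=D+A$. An eigenvalue $\mu$ of $L^+$ is a main signless Laplacian eigenvalue of $G$ if its eigenspace is not orthogonal to the all-ones vector, i.e. it has an eigenvector whose entries have nonzero sum. The length of a path is its number of edges; a pendant vertex is a vertex of degree $1$. *)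

(* Defs.v *)
From HB Require Import structures.
From mathcomp Require Import all_boot all_order all_algebra.

Set Implicit Arguments.
Unset Strict Implicit.
Unset Printing Implicit Defensive.

Import GRing.Theory Num.Theory.

Record sgraph := SGraph {
  vertex :> finType;
  adj : rel vertex;
  adj_sym : symmetric adj;
  adj_irrefl : irreflexive adj }.

Definition isomorphic (G H : sgraph) : Prop :=
  exists2 f : G -> H, bijective f & forall x y : G, adj (f x) (f y) = adj x y.

Definition connected_graph (G : sgraph) : Prop :=
  forall x y : G, connect (@adj G) x y.

Definition edges (G : sgraph) : {set {set G}} :=
  [set [set x.1; x.2] | x : G * G & adj x.1 x.2].

Definition bicyclic (G : sgraph) : Prop :=
  connected_graph G /\ #|edges G| = #|G| + 1.

Definition deg (G : sgraph) (x : G) : nat := #|[set y : G | adj x y]|.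

(* The default value #|G| is harmless: every degree is smaller than #|G|. *)
Definition min_deg (G : sgraph) : nat := \big[minn/#|G|]_(x : G) deg x.

Section SignlessLaplacian.
Local Open Scope ring_scope.
Variables (R : rcfType) (G : sgraph).

Definition degree_matrix : 'M[R]_#|G| :=
  diag_mx (\row_i (deg (enum_val i : G))%:R).

Definition adjacency_matrix : 'M[R]_#|G| :=
  \matrix_(i, j) (adj (enum_val i : G) (enum_val j : G))%:R.

Definition signless_laplacian : 'M[R]_#|G| :=
  degree_matrix + adjacency_matrix.

(* [eigenspace] is about row vectors; the signless Laplacian is symmetric, so
   left and right eigenvectors agree up to transposition. *)
Definition main_signless_eigenvalue (mu : R) : Prop :=
  eigenvalue signless_laplacian mu /\
  exists2 w : 'rV[R]_#|G|,
    (w <= eigenspace signless_laplacian mu)%MS & \sum_i w ord0 i != 0.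

Definition exactly_two_main_signless_eigenvalues : Prop :=
  exists mu1 mu2 : R, mu1 <> mu2 /\
    forall mu : R, main_signless_eigenvalue mu <-> mu = mu1 \/ mu = mu2.

End SignlessLaplacian.

(* The vertices are:
   - [inl (inl i)] with 0 <= i <= k: the path u = 0, x_1, ..., x_{k-1}, v = k;
   - [inl (inr false)], [inl (inr true)]: the vertices p and q;
   - [inr i] with 0 <= i < k - 1: the pendant vertex y_{i+1}, attached to
     x_{i+1}. *)
Definition theta_vertex (k : nat) : finType := ('I_k.+1 + bool + 'I_k.-1)%type.

Definition theta_arc (k : nat) (a b : theta_vertex k) : bool :=
  match a, b with
  | inl (inl i), inl (inl j) => i.+1 == j :> nat
  | inl (inl i), inl (inr _) => (i == 0 :> nat) || (i == k :> nat)
  | inl (inl i), inr j => i == j.+1 :> nat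
  | _, _ => false
  end.

Definition theta_adj (k : nat) : rel (theta_vertex k) :=
  fun a b => theta_arc a b || theta_arc b a.

Lemma theta_adj_sym (k : nat) : symmetric (@theta_adj k).
Proof. by move=> a b; rewrite /theta_adj orbC. Qed.

Lemma theta_adj_irrefl (k : nat) : irreflexive (@theta_adj k).
Proof.
by rewrite /theta_adj => -[[i|c]|i] //=; rewrite orbb; apply/negbTE; rewrite gtn_eqF.
Qed.

Definition theta_pendant (k : nat) : sgraph :=
  SGraph (@theta_adj_sym k) (@theta_adj_irrefl k).

(* Main.v *)
Require Import Defs.
From mathcomp Require Import all_boot all_order all_algebra.
From mathcomp Require Import complex ring lra zify.

(** Multiplying a vector [u] by [Q - mu] removes [mu] from the main eigenvalues
    of [u] and keeps the others, and a nonzero vector has a main eigenvalue. So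
    in a graph which is not regular, [mu1 != mu2] are the main eigenvalues iff
    [(Q - mu1)(Q - mu2)] kills the all-ones vector, which means
    [d(v)^2 + sum_(u ~ v) d(u) = a d(v) + b] for all [v]. Writing [x = d - 1] and
    [e] for the value of [x] at a neighbour of a pendant vertex, this becomes
    [sum_(u ~ v) x(u) + x (x + 1) = c x + e (x + 1)], where [c] is an integer.
    Deleting the pendant vertices leaves a core of minimum degree 2 whose degrees
    [d'] satisfy [sum (d' - 2) = 2]; a core vertex has [x = e] if it carries
    pendant vertices and [x = d' - 1] in [{1, 2, 3}] otherwise. Summing the
    equation over the core relates the sizes of these four classes, and together
    with the equation at single vertices it forces [c = e = 2]: two vertices
    without pendant neighbours have [x = 1] and two have [x = 2]. By parity, the
    latter two are joined by a path through vertices with [x = 2]. This embeds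
    some [theta_pendant k] into [G] with the right degrees, hence onto [G]. *)

Set Implicit Arguments.
Unset Strict Implicit.
Unset Printing Implicit Defensive.
Import Order.TTheory GRing.Theory Num.Theory.

(** * Main eigenvalues *)

Section HermitianEigenvectors.
Local Open Scope ring_scope.
Local Open Scope sesquilinear_scope.

Lemma hermitian_eigenvector_nonorthogonal (C : numClosedFieldType) n
    (A : 'M[C]_n) (u : 'rV_n) :
    A \is hermsymmx -> u != 0 ->
  exists mu (z : 'rV_n),
    [/\ mu \is Num.real, z *m A = mu *: z & z *m u^t* != 0].
Proof.
move=> hermA u_neq0; set P := spectralmx A; set sp := spectral_diag A.
have uniP : P \is unitarymx := spectral_unitarymx A.
have AE : A = invmx P *m diag_mx sp *m P.
  exact/orthomx_spectralP/hermitian_normalmx.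
have [i Pi] : exists i, row i P *m u^t* != 0.
  apply/existsP; apply: contraNT u_neq0 => /existsPn orth.
  have Pu : P *m u^t* = 0.
    by apply/row_matrixP => i; rewrite row_mul row0; exact/eqP/negPn/orth.
  rewrite -[u]trmxCK -[u^t*](mulKmx (spectral_unit A)) Pu.
  by rewrite mulmx0 trmx0 map_mx0.
exists (sp 0 i), (row i P); split=> //.
  exact: mxOverP (hermitian_spectral_diag_real hermA) 0 i.
rewrite {1}AE !mulmxA -row_mul mulmxV ?unitarymx_unit //.
by rewrite -row_mul mul1mx row_diag_mx -scalemxAl -rowE.
Qed.

Lemma real_complexM (R : rcfType) (a : R) (z : Rcomplex R) :
  real_complex R a * (z : R[i]) = a *: z.
Proof.
case: z => x y; apply/eqP.
by rewrite eq_complex /= !mul0r subr0 addr0 !eqxx.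
Qed.

Lemma map_mx_scalar_mul (R : rcfType) m n p (phi : {scalar Rcomplex R})
    (z : 'M[R[i]]_(m, n)) (B : 'M[R]_(n, p)) :
  map_mx phi (z *m map_mx (real_complex R) B) = map_mx phi z *m B.
Proof.
apply/matrixP => i j; rewrite !mxE [LHS](raddf_sum phi); apply: eq_bigr => k _.
by rewrite !mxE [RHS]mulrC -[RHS](scalarZ phi) -real_complexM mulrC.
Qed.

End HermitianEigenvectors.

Section MainEigenvalues.
Local Open Scope ring_scope.
Local Open Scope sesquilinear_scope.
Variables (R : rcfType) (n : nat) (A : 'M[R]_n).
Hypothesis symA : A^T = A.
Implicit Types (u w : 'rV[R]_n) (mu nu : R).

Definition main_eigenvalue u mu : Prop :=
  exists2 w : 'rV_n, w *m A = mu *: w & w *m u^T != 0.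

Lemma mulmx_tr_eq0 w : (w *m w^T == 0) = (w == 0).
Proof.
apply/eqP/eqP => [/rowP/(_ 0)|->]; last by rewrite mul0mx.
rewrite !mxE => /eqP; rewrite psumr_eq0 => [/allP w0|i _]; last first.
  by rewrite mxE -expr2 sqr_ge0.
apply/rowP => i; have := w0 i (mem_index_enum _).
by rewrite /= !mxE mulf_eq0 orbb => /eqP.
Qed.

Lemma main_eigenvalue_mulB u mu nu :
  main_eigenvalue (u *m (A - nu%:M)) mu <-> mu != nu /\ main_eigenvalue u mu.
Proof.
have dotE w : w *m A = mu *: w ->
    w *m (u *m (A - nu%:M))^T = (mu - nu) *: (w *m u^T).
  move=> wA; rewrite trmx_mul linearB /= symA tr_scalar_mx mulmxA mulmxBr wA.
  by rewrite mul_mx_scalar -scalerBl scalemxAl.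
split=> [[w wA]|[mu_nu [w wA wu]]]; last first.
  by exists w; rewrite // dotE // scaler_eq0 negb_or subr_eq0 mu_nu.
rewrite dotE // scaler_eq0 negb_or subr_eq0 => /andP [mu_nu wu].
by split=> //; exists w.
Qed.

Lemma main_eigenvalue_self w mu :
  w != 0 -> w *m (A - mu%:M) = 0 -> main_eigenvalue w mu.
Proof.
move=> w_neq0 wA; exists w; last by rewrite mulmx_tr_eq0.
by apply/eqP; rewrite -subr_eq0 -mul_mx_scalar -mulmxBr wA.
Qed.

Lemma complex_main_eigenvalue u mu (z : 'rV[R[i]]_n) :
    z *m map_mx (real_complex R) A = real_complex R mu *: z ->
    z *m map_mx (real_complex R) u^T != 0 ->
  main_eigenvalue u mu.
Proof.
move=> zA zu.
have eigen (phi : {scalar Rcomplex R}) :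
    map_mx phi z *m A = mu *: map_mx phi z.
  rewrite -map_mx_scalar_mul zA; apply/matrixP => i j; rewrite !mxE.
  by rewrite -[RHS](scalarZ phi) -real_complexM.
pose Re := @complex.Re R; pose Im := @complex.Im R.
have [Re_u|Re_u] := eqVneq (map_mx Re z *m u^T) 0; last first.
  by exists (map_mx Re z); first exact: (eigen Re).
exists (map_mx Im z); first exact: (eigen Im).
apply: contraNneq zu => Im_u; apply/eqP/matrixP => i j; rewrite [RHS]mxE.
have /matrixP/(_ i j) := Re_u; rewrite -(map_mx_scalar_mul Re).
have /matrixP/(_ i j) := Im_u; rewrite -(map_mx_scalar_mul Im).
by rewrite !mxE /=; case: (\sum_k _) => x y /= -> ->.
Qed.

Lemma main_eigenvalue_exists u : u != 0 -> exists mu, main_eigenvalue u mu.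
Proof.
move=> u_neq0; pose toC := real_complex R.
have conj_real m p (B : 'M[R]_(m, p)) : (map_mx toC B)^t* = map_mx toC B^T.
  apply/matrixP => i j; rewrite !mxE.
  by apply/CrealP/complex_realP; exists (B j i).
have hermA : map_mx toC A \is hermsymmx.
  by apply/is_hermitianmxP; rewrite expr0 scale1r conj_real symA.
have uC_neq0 : map_mx toC u != 0 by rewrite map_mx_eq0.
have [_ [z [/complex_realP [mu ->] zA zu]]] :=
  hermitian_eigenvector_nonorthogonal hermA uC_neq0.
by exists mu; apply: complex_main_eigenvalue zA _; rewrite -conj_real.
Qed.

Lemma two_main_eigenvaluesP u mu1 mu2 :
    u *m (A - mu1%:M) != 0 -> u *m (A - mu2%:M) != 0 ->
  (forall mu, main_eigenvalue u mu <-> mu = mu1 \/ mu = mu2) <->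
  u *m (A - mu1%:M) *m (A - mu2%:M) = 0.
Proof.
move=> u_mu1 u_mu2; split=> [mainP|ann].
  apply/eqP; apply: contraT => /main_eigenvalue_exists [mu].
  case/main_eigenvalue_mulB => mu_mu2 /main_eigenvalue_mulB [mu_mu1 /mainP].
  by case=> mu_eq; rewrite mu_eq eqxx in mu_mu1 mu_mu2.
have ann_sym : u *m (A - mu2%:M) *m (A - mu1%:M) = 0.
  have commA nu : comm_mx (A - nu%:M) A.
    by apply/comm_mx_sym/comm_mxB; [exact: comm_mx_refl|exact: comm_mx_scalar].
  by rewrite -mulmxA -(comm_mxB (commA mu1) (comm_mx_scalar mu2 _)) mulmxA.
move=> mu; split=> [main_mu|[->|->]].
- have [->|mu_mu1] := eqVneq mu mu1; first by left.
  have [->|mu_mu2] := eqVneq mu mu2; first by right.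
  have : main_eigenvalue (u *m (A - mu1%:M) *m (A - mu2%:M)) mu.
    by do 2![apply/main_eigenvalue_mulB; split=> //].
  by rewrite ann => -[w _]; rewrite trmx0 mulmx0 eqxx.
- by have /main_eigenvalue_mulB [] := main_eigenvalue_self u_mu2 ann_sym.
- by have /main_eigenvalue_mulB [] := main_eigenvalue_self u_mu1 ann.
Qed.

End MainEigenvalues.

Section SignlessLaplacian.
Local Open Scope ring_scope.
Variables (R : rcfType) (G : sgraph).
Implicit Types (f : G -> R) (v : G) (mu : R).

Local Notation Q := (signless_laplacian R G).
Local Notation ones := (const_mx 1 : 'rV[R]_#|G|).

Definition degree_equation (a b : R) : Prop := forall v,
  (deg v)%:R ^+ 2 + \sum_(u | adj v u) (deg u)%:R = a * (deg v)%:R + b.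

Definition vertex_row f : 'rV[R]_#|G| := \row_i f (enum_val i).

Lemma tr_signless_laplacian : Q^T = Q.
Proof.
rewrite /signless_laplacian linearD /= /degree_matrix tr_diag_mx; congr (_ + _).
by apply/matrixP => i j; rewrite !mxE adj_sym.
Qed.

Lemma vertex_row_eq0 f : vertex_row f = 0 <-> forall v, f v = 0.
Proof.
split=> [/rowP f0 v|f0]; last by apply/rowP => i; rewrite !mxE f0.
by have := f0 (enum_rank v); rewrite !mxE enum_rankK.
Qed.

Lemma vertex_row_mul f mu : vertex_row f *m (Q - mu%:M) =
  vertex_row (fun v => (deg v)%:R * f v + \sum_(u | adj v u) f u - mu * f v).
Proof.
rewrite mulmxBr mul_mx_scalar mulmxDr mul_mx_diag.
apply/rowP => i; rewrite !mxE mulrC; congr (_ + _ - _).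
rewrite (reindex_onto enum_rank enum_val) /= => [|k _]; last first.
  by rewrite enum_valK.
rewrite [RHS]big_mkcond; apply: eq_big => [u|u _].
  by rewrite enum_rankK eqxx.
rewrite !mxE enum_rankK adj_sym mulrC.
by case: adj; rewrite ?mul1r ?mul0r.
Qed.

Lemma sum_adj_const (x : R) v : \sum_(u | adj v u) x = (deg v)%:R * x.
Proof. by rewrite sumr_const mulr_natl /deg cardsE. Qed.

Lemma ones_mul_signless mu :
  ones *m (Q - mu%:M) = vertex_row (fun v => 2 * (deg v)%:R - mu).
Proof.
have -> : ones = vertex_row (fun=> 1) by apply/rowP => i; rewrite !mxE.
rewrite vertex_row_mul; apply/rowP => i; rewrite !mxE sum_adj_const.
by rewrite !mulr1 mulr_natl mulr2n.
Qed.

Lemma ones_annihilatedP mu1 mu2 :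
  ones *m (Q - mu1%:M) *m (Q - mu2%:M) = 0 <->
  degree_equation (mu1 + mu2) (- (mu1 * mu2 / 2)).
Proof.
rewrite ones_mul_signless vertex_row_mul vertex_row_eq0.
have coordE v : (deg v)%:R * (2 * (deg v)%:R - mu1) +
    \sum_(u | adj v u) (2 * (deg u)%:R - mu1) - mu2 * (2 * (deg v)%:R - mu1)
  = 2 * ((deg v)%:R ^+ 2 + \sum_(u | adj v u) (deg u)%:R
            - ((mu1 + mu2) * (deg v)%:R - mu1 * mu2 / 2)).
  by rewrite sumrB sum_adj_const -mulr_sumr; field.
split=> degE v; last by rewrite coordE degE subrr mulr0.
have /eqP := degE v.
by rewrite coordE mulf_eq0 pnatr_eq0 subr_eq0 => /eqP.
Qed.

Lemma main_signless_eigenvalueP mu :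
  main_signless_eigenvalue G mu <-> main_eigenvalue Q ones mu.
Proof.
have onesE (w : 'rV_#|G|) : (w *m ones^T == 0) = (\sum_i w ord0 i == 0).
  have sumE : (w *m ones^T) 0 0 = \sum_i w ord0 i.
    by rewrite mxE; apply: eq_bigr => i _; rewrite !mxE mulr1.
  apply/eqP/eqP => [w0|]; first by rewrite -sumE w0 mxE.
  by rewrite -sumE => w0; rewrite [LHS]mx11_scalar w0 raddf0.
split=> [[_ [w /eigenspaceP wQ w0]]|[w wQ]]; first by exists w; rewrite ?onesE.
rewrite onesE => w0; split; last by exists w => //; apply/eigenspaceP.
apply/eigenvalueP; exists w => //.
by apply: contraNneq w0 => ->; rewrite big1 // => i _; rewrite mxE.
Qed.

Lemma exactly_two_main_signless_eigenvaluesP (x y : G) : deg x != deg y ->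
  exactly_two_main_signless_eigenvalues R G <->
  exists a b, 0 < a ^+ 2 + 8 * b /\ degree_equation a b.
Proof.
move=> deg_xy.
have ones_neq0 mu : ones *m (Q - mu%:M) != 0.
  apply: contra deg_xy => /eqP.
  rewrite ones_mul_signless => /vertex_row_eq0 deg_mu.
  have := etrans (deg_mu x) (esym (deg_mu y)).
  by move/addIr/mulfI=> /(_ _)/eqP; rewrite eqr_nat; apply; rewrite pnatr_eq0.
have mainP mu1 mu2 := two_main_eigenvaluesP tr_signless_laplacian
  (ones_neq0 mu1) (ones_neq0 mu2).
split=> [[mu1 [mu2 [mu12 two_main]]]|[a [b [discr_gt0 degE]]]].
  exists (mu1 + mu2), (- (mu1 * mu2 / 2)); split.
    have -> : (mu1 + mu2) ^+ 2 + 8 * - (mu1 * mu2 / 2) = (mu1 - mu2) ^+ 2.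
      by field.
    by rewrite exprn_even_gt0 //= subr_eq0; exact/eqP.
  apply/ones_annihilatedP/mainP => mu.
  exact: iff_trans (iff_sym (main_signless_eigenvalueP mu)) (two_main mu).
pose s := Num.sqrt (a ^+ 2 + 8 * b).
have s2 : s ^+ 2 = a ^+ 2 + 8 * b by rewrite sqr_sqrtr // ltW.
have s_gt0 : 0 < s by rewrite sqrtr_gt0.
exists ((a + s) / 2), ((a - s) / 2); split=> [|mu]; first by lra.
apply: iff_trans (main_signless_eigenvalueP mu) _; move: mu.
apply/mainP/ones_annihilatedP => v; rewrite degE; congr (_ * _ + _).
  by field.
have -> : (a + s) / 2 * ((a - s) / 2) / 2 = (a ^+ 2 - s ^+ 2) / 8 by field.
by rewrite s2; field.
Qed.

End SignlessLaplacian.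

(** * Degrees and neighbour sums *)

Lemma eq_sum_const (T : finType) (A : {set T}) (f : T -> nat) k :
  (forall x, x \in A -> f x = k) -> \sum_(x in A) f x = #|A| * k.
Proof. by move=> fk; rewrite (eq_bigr _ fk) sum_nat_const. Qed.

Lemma adj_neq (G : sgraph) (u v : G) : adj u v -> u != v.
Proof. by apply: contraTneq => ->; rewrite adj_irrefl. Qed.

Lemma handshake (G : sgraph) : \sum_(v : G) deg v = 2 * #|edges G|.
Proof.
pose arcs := [set x : G * G | adj x.1 x.2].
have -> : \sum_(v : G) deg v = \sum_(x in arcs) 1.
  under eq_bigr do rewrite /deg -sum1dep_card.
  by rewrite pair_big_dep; apply: eq_bigl => x; rewrite inE.
have edgesE : edges G = [set [set x.1; x.2] | x in arcs].
  by apply/setP => E; apply/imsetP/imsetP => -[x]; rewrite inE => x_arc ->;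
     exists x; rewrite ?inE.
rewrite edgesE (partition_big_imset (fun x => [set x.1; x.2])) /=.
rewrite mulnC -sum_nat_const; apply: eq_bigr => E /imsetP [[a b]].
rewrite inE /= => ab ->{E}; rewrite sum1_card.
have <- : #|[set (a, b); (b, a)]| = 2.
  by rewrite cards2 xpair_eqE negb_and adj_neq.
apply: eq_card => -[u v]; rewrite unfold_in /= !inE !xpair_eqE.
apply/andP/orP => /= [[uv /eqP uvE]|]; last first.
  by case=> /andP [/eqP -> /eqP ->]; rewrite ?ab // adj_sym ab setUC.
have /set2P u_ab : u \in [set a; b] by rewrite -uvE set21.
have /set2P v_ab : v \in [set a; b] by rewrite -uvE set22.
by case: u_ab v_ab (adj_neq uv) => -> [] ->; rewrite !eqxx //; [left|right].
Qed.

Section Neighbours.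
Variable G : sgraph.
Implicit Types (u v w : G) (W : {set G}) (f : G -> nat).

Definition nbr_sum f v := \sum_(u | adj v u) f u.

Definition deg_in W v := #|[set u in W | adj v u]|.

Lemma nbr_sum_ge_seq f v (s : seq G) :
  uniq s -> all (adj v) s -> \sum_(u <- s) f u <= nbr_sum f v.
Proof.
move=> uniq_s /allP adj_s; rewrite big_uniq //= /nbr_sum.
rewrite big_mkcond [leqRHS]big_mkcond.
by apply: leq_sum => u _; case: ifP => // /adj_s ->.
Qed.

Lemma eq_nbr_sum f g v :
  (forall u, adj v u -> f u = g u) -> nbr_sum f v = nbr_sum g v.
Proof. by move=> fg; apply: eq_bigr. Qed.

Lemma degE v : deg v = nbr_sum (fun=> 1) v.
Proof. by rewrite /nbr_sum sum1dep_card. Qed.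

Lemma deg_inE W v : deg_in W v = nbr_sum (fun u => u \in W : nat) v.
Proof.
rewrite /deg_in -sum1dep_card /nbr_sum big_mkcond [RHS]big_mkcond.
by apply: eq_bigr => u _; case: (u \in W); case: adj.
Qed.

Lemma deg_in_gt0P W v : reflect (exists2 u, u \in W & adj v u) (0 < deg_in W v).
Proof.
apply: (iffP card_gt0P) => [[u]|[u uW vu]].
  by rewrite inE => /andP [uW vu]; exists u.
by exists u; rewrite inE uW.
Qed.

Lemma deg_in_setC W v : deg v = deg_in W v + deg_in (~: W) v.
Proof.
rewrite /deg -(cardsID W); congr (_ + _); apply: eq_card => u.
  by rewrite !inE andbC.
by rewrite !inE.
Qed.

Lemma deg_in_le W v : deg_in W v <= #|W|.
Proof. by apply/subset_leq_card/subsetP => u; rewrite inE => /andP []. Qed.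

Lemma deg_in_full W v u : #|W| <= deg_in W v -> u \in W -> adj v u.
Proof.
move=> full; suff <- : [set u in W | adj v u] = W by rewrite inE => /andP [].
apply/eqP; rewrite eqEcard full andbT.
by apply/subsetP => w; rewrite inE => /andP [].
Qed.

Lemma deg_in_lt W v : v \in W -> deg_in W v < #|W|.
Proof.
move=> vW; rewrite ltnNge; apply/negP => /deg_in_full/(_ vW).
by rewrite adj_irrefl.
Qed.

Lemma deg_in_le1_uniq W v u w :
  deg_in W v <= 1 -> u \in W -> adj v u -> w \in W -> adj v w -> u = w.
Proof.
by move=> /card_le1_eqP uniqW *; apply: uniqW; rewrite inE; apply/andP.
Qed.

Lemma deg1_uniq v u w : deg v = 1 -> adj v u -> adj v w -> u = w.
Proof.
move=> v1 vu vw; apply: (@deg_in_le1_uniq setT v); rewrite ?inE //.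
by rewrite -v1 (deg_in_setC setT) leq_addr.
Qed.

Lemma nbr_sum_deg1 f v u : deg v = 1 -> adj v u -> nbr_sum f v = f u.
Proof.
move=> v1 vu; rewrite /nbr_sum (big_pred1 u) // => w.
by apply/idP/eqP => [vw|-> //]; exact: deg1_uniq v1 vw vu.
Qed.

Lemma sum_nbr_sum W f : \sum_(v in W) nbr_sum f v = \sum_u f u * deg_in W u.
Proof.
rewrite (exchange_big_dep predT) //=; apply: eq_bigr => u _.
rewrite sum_nat_const mulnC; congr (_ * _); apply: eq_card => v.
by rewrite !inE adj_sym.
Qed.

Lemma sum_deg_in W W' : \sum_(v in W) deg_in W' v = \sum_(v in W') deg_in W v.
Proof.
under eq_bigr do rewrite deg_inE.
rewrite sum_nbr_sum [RHS]big_mkcond; apply: eq_bigr => u _.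
by case: (u \in W'); rewrite ?mul1n ?mul0n.
Qed.

Lemma sum_deg_in_card_gt3 W :
  \sum_(v in W) deg_in W v = 2 * #|W| + 2 -> 3 < #|W|.
Proof.
have : \sum_(v in W) deg_in W v <= #|W| * #|W|.-1.
  by rewrite -sum_nat_const; apply: leq_sum => v /deg_in_lt; case: #|W|.
by move=> + sumE; rewrite sumE; nia.
Qed.

Lemma connected_closed W v : connected_graph G -> v \in W ->
  (forall x y, x \in W -> adj x y -> y \in W) -> W = setT.
Proof.
move=> connG vW closedW; apply/setP => u.
rewrite inE -(closed_connect _ (connG v u)) // => x y xy.
apply/idP/idP => [/closedW/(_ xy) //|].
by move/closedW; apply; rewrite adj_sym.
Qed.

End Neighbours.

Section Restriction.
Variables (G : sgraph) (W : {set G}).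

Definition restrict_adj : rel G := fun x y => [&& x \in W, y \in W & adj x y].

Lemma restrict_adj_sym : symmetric restrict_adj.
Proof. by move=> x y; rewrite /restrict_adj andbCA adj_sym. Qed.

Lemma restrict_adj_irrefl : irreflexive restrict_adj.
Proof. by move=> x; rewrite /restrict_adj adj_irrefl !andbF. Qed.

(* The vertices outside [W] are kept, as isolated vertices. *)
Definition restrict : sgraph := SGraph restrict_adj_sym restrict_adj_irrefl.

Lemma deg_restrict (v : G) :
  deg (v : restrict) = if v \in W then deg_in W v else 0.
Proof.
rewrite /deg /deg_in /= /restrict_adj; case: ifP => // _ /=.
by apply: eq_card0 => u; rewrite inE.
Qed.

Lemma sum_deg_in_restrict :
  \sum_(v in W) deg_in W v = 2 * #|edges restrict|.
Proof.
rewrite -handshake big_mkcond /=.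
by apply: eq_bigr => v _; rewrite (deg_restrict v).
Qed.

End Restriction.

Lemma odd_deg_connect (G : sgraph) (a b : G) :
    odd (deg a) -> (forall v, v != a -> v != b -> ~~ odd (deg v)) ->
  connect (@adj G) a b.
Proof.
move=> odd_a even_rest; apply: contraT => not_ab.
pose C := [set v | connect (@adj G) a v].
have degC v : v \in C -> deg_in C v = deg v.
  rewrite inE => av; apply: eq_card => u; rewrite !inE andbC.
  by case: (boolP (adj v u)) => //= vu; rewrite (connect_trans av) ?connect1.
have aC : a \in C by rewrite inE.
have /(congr1 odd) := sum_deg_in_restrict C.
rewrite (eq_bigr _ degC) mul2n odd_double (bigD1 a) //= oddD odd_a.
suff : 2 %| \sum_(v in C | v != a) deg v by rewrite dvdn2 => /negPf ->.
apply: dvdn_sum => v /andP [vC va]; rewrite dvdn2 even_rest //.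
by apply: contraNneq not_ab => <-; rewrite inE in vC.
Qed.

Lemma deg_isomorphic (G H : sgraph) (f : G -> H) :
    bijective f -> (forall x y, adj (f x) (f y) = adj x y) ->
  forall v, deg (f v) = deg v.
Proof.
move=> [g fK gK] adjf v; rewrite /deg -(card_imset _ (can_inj fK)).
apply: eq_card => y; rewrite -[y]gK mem_imset ?inE ?adjf //; exact: can_inj fK.
Qed.

Lemma degree_equation_isomorphic (R : rcfType) (G H : sgraph) (a b : R) :
  isomorphic G H -> degree_equation H a b -> degree_equation G a b.
Proof.
move=> [f bij_f adjf] degE v; have degf := deg_isomorphic bij_f adjf.
have := degE (f v); rewrite degf => <-; congr (_ + _)%R.
rewrite [RHS](reindex f) /=; last exact: onW_bij.
by apply: eq_big => u; rewrite ?adjf ?degf.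
Qed.

(* Injectivity and equal degrees make [h] a local isomorphism, so its image is
   closed under adjacency and connectedness gives surjectivity. *)
Lemma injective_deg_hom_isomorphic (G H : sgraph) (h : H -> G) (x0 : H) :
    connected_graph G -> injective h ->
    (forall x y, adj x y -> adj (h x) (h y)) ->
    (forall x, deg (h x) = deg x) ->
  isomorphic G H.
Proof.
move=> connG inj_h homh degh.
have nbrh x : [set y | adj (h x) y] = h @: [set y | adj x y].
  apply/esym/eqP; rewrite eqEcard card_imset // -/(deg x) -/(deg (h x)) degh.
  rewrite leqnn andbT; apply/subsetP => _ /imsetP [y + ->].
  by rewrite !inE; exact: homh.
have adjh x y : adj (h x) (h y) = adj x y.
  by have /setP/(_ (h y)) := nbrh x; rewrite mem_imset // !inE.
have surj : h @: setT = setT.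
  apply: (@connected_closed _ _ (h x0) connG) => [|_ u /imsetP [x _ ->] xu].
    exact: imset_f.
  have : u \in [set y | adj (h x) y] by rewrite inE.
  by rewrite nbrh => /imsetP [y _ ->]; exact: imset_f.
have im_h u : u \in codom h.
  have : u \in h @: setT by rewrite surj inE.
  by case/imsetP => x _ ->; exact: codom_f.
exists (fun u => iinv (im_h u)) => [|u v]; last by rewrite -adjh !f_iinv.
by exists h => x; [exact: f_iinv|apply: inj_h; exact: f_iinv].
Qed.

(** * Bicyclic graphs and the excess equation *)

Lemma muln_biggcdr (I : finType) (x : I -> nat) k :
  \big[gcdn/0]_i (k * x i) = k * \big[gcdn/0]_i x i.
Proof.
by apply/esym/(big_morph (muln k)) => [m n|]; rewrite ?muln_gcdr ?muln0.
Qed.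

Section Bicyclic.
Variable G : sgraph.
Hypothesis bicG : bicyclic G.
Implicit Types u v w : G.

Let connG : connected_graph G := bicG.1.

Lemma bicyclic_card_gt3 : 3 < #|G|.
Proof.
rewrite -cardsT; apply: sum_deg_in_card_gt3.
have := handshake G; rewrite bicG.2 mulnDr muln1 -cardsT => <-.
by apply: eq_big => v; rewrite ?inE // => _; apply: eq_card => u; rewrite !inE.
Qed.

Lemma bicyclic_closed_gt3 (W : {set G}) v :
  v \in W -> (forall x y, x \in W -> adj x y -> y \in W) -> 3 < #|W|.
Proof.
move=> vW closedW; rewrite (connected_closed connG vW closedW) cardsT.
exact: bicyclic_card_gt3.
Qed.

Lemma bicyclic_deg_gt0 v : 0 < deg v.
Proof.
rewrite lt0n; apply/negP; rewrite cards_eq0 => /eqP no_nbr.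
suff : 3 < #|[set v]| by rewrite cards1.
apply: (bicyclic_closed_gt3 (set11 v)) => x y /set1P -> vy.
by have /setP/(_ y) := no_nbr; rewrite !inE vy.
Qed.

Lemma bicyclic_leaves_nonadjacent u v : deg u = 1 -> deg v = 1 -> ~~ adj u v.
Proof.
move=> u1 v1; apply/negP => uv; have vu : adj v u by rewrite adj_sym.
suff : 3 < #|[set u; v]| by rewrite cards2; case: eqP.
apply: (bicyclic_closed_gt3 (set21 u v)) => x y /set2P [] -> xy.
  by rewrite (deg1_uniq u1 xy uv) set22.
by rewrite (deg1_uniq v1 xy vu) set21.
Qed.

Lemma bicyclic_leaf : min_deg G = 1 -> exists v : G, deg v = 1.
Proof.
move=> min1; have : min_deg G = #|G| \/ exists v : G, deg v = min_deg G.
  apply: (big_ind (fun k => k = #|G| \/ exists v : G, deg v = k)).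
  - by left.
  - by move=> k k' ? ?; rewrite /minn; case: ifP.
  - by move=> v _; right; exists v.
by rewrite min1; case=> // G1; have := bicyclic_card_gt3; rewrite -G1.
Qed.

Definition excess v := (deg v).-1.

Definition nbr_excess v := nbr_sum excess v.

Lemma deg_excess v : deg v = (excess v).+1.
Proof. by rewrite prednK // bicyclic_deg_gt0. Qed.

Lemma nbr_sum_deg v : nbr_sum (@deg G) v = nbr_excess v + deg v.
Proof.
rewrite [in RHS]degE /nbr_excess -big_split; apply: eq_bigr => u _ /=.
by rewrite deg_excess addn1.
Qed.

Definition excess_equation (c e : nat) : Prop := forall v,
  nbr_excess v + excess v * (excess v).+1 = c * excess v + e * (excess v).+1.

Section LeafEdge.
Variables (l r : G).
Hypotheses (l1 : deg l = 1) (lr : adj l r).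

Lemma leaf_nbr_excess_gt0 : 0 < excess r.
Proof.
rewrite lt0n; apply: contraL lr => /eqP r0.
by apply: bicyclic_leaves_nonadjacent => //; rewrite deg_excess r0.
Qed.

(* The equations at the two ends of the pendant edge determine [a] and [b]. *)
Lemma scaled_excess_equation (R : rcfType) (a b : R) v :
    degree_equation G a b ->
  excess r * (nbr_excess v + excess v * (excess v).+1) =
  nbr_excess r * excess v + excess r * (excess r * (excess v).+1).
Proof.
move=> degE.
have excessE u : (((excess u)%:R + 1) ^+ 2 + (nbr_excess u)%:R
    + (excess u)%:R + 1 = a * ((excess u)%:R + 1) + b)%R.
  have := degE u; rewrite -natr_sum -/(nbr_sum (@deg G) u) nbr_sum_deg.
  by rewrite deg_excess natrD -natr1 => <-; rewrite !addrA.
have leaf_excess : excess l = 0 by rewrite /excess l1.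
have lE := excessE l.
rewrite /nbr_excess (nbr_sum_deg1 _ l1 lr) leaf_excess in lE.
have rE := excessE r; have vE := excessE v.
apply/eqP; rewrite -(eqr_nat R) !(natrD, natrM) -!natr1; apply/eqP.
move: (nbr_excess v)%:R%R (excess v)%:R%R vE => X x vE.
move: (nbr_excess r)%:R%R (excess r)%:R%R rE lE => K e rE lE.
have axE : (a * x = X + x ^+ 2 + 3 * x - e)%R by lra.
have aeE : (a * e = K + e ^+ 2 + 2 * e)%R by lra.
have : (e * (a * x) = x * (a * e))%R by ring.
by rewrite axE aeE; lra.
Qed.

(* The gcd [g] of all excesses divides both sides, so [g] times the coefficient
   of [excess v] is an integer multiple of [g]. *)
Lemma excess_equation_exists (R : rcfType) (a b : R) :
  degree_equation G a b -> exists c, excess_equation c (excess r).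
Proof.
move=> degE; have eqn v := scaled_excess_equation v degE.
set e := excess r in eqn *; set K := nbr_excess r in eqn.
have e_gt0 : 0 < e := leaf_nbr_excess_gt0.
pose g := \big[gcdn/0]_v excess v.
have g_excess v : g %| excess v by exact: (biggcdn_inf v).
have eg_dvd v : e * g %| K * excess v.
  have : e * g %| e * (nbr_excess v + excess v * (excess v).+1).
    by rewrite dvdn_mul // dvdn_add ?dvdn_mulr // dvdn_sum.
  by rewrite eqn dvdn_addl // dvdn_mul // dvdn_mulr // g_excess.
have /dvdnP [c KE] : e %| K.
  have g_gt0 : 0 < g := dvdn_gt0 e_gt0 (g_excess r).
  have KgE : K * g = \big[gcdn/0]_v (K * excess v) by rewrite muln_biggcdr.
  rewrite -(dvdn_pmul2r g_gt0) KgE.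
  by apply/dvdn_biggcdP => v _; exact: eg_dvd.
exists c => v; apply/eqP; rewrite -(eqn_pmul2l e_gt0) eqn KE.
by apply/eqP; ring.
Qed.

End LeafEdge.
End Bicyclic.

(** * The core *)

Section Core.
Variable G : sgraph.
Hypothesis bicG : bicyclic G.
Implicit Types (u v w x y : G) (W : {set G}).

Definition leaves : {set G} := [set v | deg v == 1].
Definition core : {set G} := ~: leaves.
Definition supports : {set G} := [set v in core | 0 < deg_in leaves v].
Definition bare i : {set G} := [set v in core :\: supports | excess v == i].

Lemma in_core v : (v \in core) = (deg v != 1).
Proof. by rewrite !inE. Qed.

Lemma in_bare i v :
  (v \in bare i) = [&& v \in core, v \notin supports & excess v == i].
Proof. by rewrite inE in_setD [X in X && _]andbC andbA. Qed.

Lemma bare_core i v : v \in bare i -> v \in core.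
Proof. by rewrite in_bare => /and3P []. Qed.

Lemma bare_excess i v : v \in bare i -> excess v = i.
Proof. by rewrite in_bare => /and3P [_ _ /eqP]. Qed.

Lemma leaf_nbr_core v u : v \in leaves -> adj v u -> u \in core.
Proof.
rewrite in_core inE => /eqP v1; apply: contraTneq.
exact: bicyclic_leaves_nonadjacent.
Qed.

Lemma deg_core_leaves v : deg v = deg_in core v + deg_in leaves v.
Proof. by rewrite (deg_in_setC core) setCK. Qed.

Lemma leaf_core_deg v : v \in leaves -> deg_in core v = 1.
Proof.
move=> v_leaf; have := deg_core_leaves v.
have /eqP -> : deg v == 1 by rewrite inE in v_leaf.
have [/deg_in_gt0P [u + vu]|] := ltnP 0 (deg_in leaves v); last by lia.
by have := leaf_nbr_core v_leaf vu; rewrite inE => /negP.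
Qed.

Lemma sum_core_deg : \sum_(v in core) deg_in core v = 2 * #|core| + 2.
Proof.
have sum_leaves : \sum_(v in leaves) deg v = #|leaves|.
  by rewrite -sum1_card; apply: eq_bigr => v; rewrite inE => /eqP.
have sum_core :
    \sum_(v in core) deg v = \sum_(v in core) deg_in core v + #|leaves|.
  rewrite (eq_bigr _ (fun v _ => deg_core_leaves v)) big_split /=.
  by rewrite (sum_deg_in core) (eq_bigr _ leaf_core_deg) sum1_card.
have := handshake G; rewrite bicG.2 (bigID (mem leaves)) /= sum_leaves.
rewrite (eq_bigl (fun v => v \in core)) => [|v]; last by rewrite in_setC.
by rewrite -(cardsC leaves) -/core sum_core; lia.
Qed.

Lemma core_closed_subset W v : v \in core -> v \in W ->
    (forall x y, x \in core :&: W -> y \in core -> adj x y -> y \in W) ->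
  core \subset W.
Proof.
move=> v_core vW closedW.
pose V := (core :&: W) :|: [set x in leaves | 0 < deg_in (core :&: W) x].
have VT : V = setT.
  apply: (@connected_closed _ _ v bicG.1) => [|x y].
    by rewrite in_setU in_setI v_core vW.
  case/setUP => [xW|/setIdP [x_leaf /deg_in_gt0P [z zW xz]]] xy; last first.
    rewrite inE in x_leaf.
    by rewrite (deg1_uniq (eqP x_leaf) xy xz) in_setU zW.
  have [y_core|] := boolP (y \in core).
    by rewrite in_setU in_setI y_core (closedW x).
  rewrite in_setC negbK in_setU => y_leaf; apply/orP; right.
  by apply/setIdP; split=> //; apply/deg_in_gt0P; exists x; rewrite // adj_sym.
apply/subsetP => x x_core; have : x \in V by rewrite VT inE.
case/setUP => [/setIP [] //|/setIdP [x_leaf _]].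
by rewrite in_setC x_leaf in x_core.
Qed.

Section ExcessEquation.
Variables c e : nat.
Hypothesis eqn : excess_equation G c e.

Lemma excess_core_gt0 v : v \in core -> 0 < excess v.
Proof. by rewrite in_core deg_excess // eqSS lt0n. Qed.

Lemma excess_leaf v : v \in leaves -> excess v = 0.
Proof. by rewrite inE /excess => /eqP ->. Qed.

Lemma support_excess v : v \in supports -> excess v = e.
Proof.
case/setIdP => _ /deg_in_gt0P [u u_leaf]; rewrite adj_sym => uv.
have := eqn u; rewrite excess_leaf //.
rewrite !(muln0, mul0n, muln1, add0n, addn0) => <-.
rewrite inE in u_leaf.
by rewrite /nbr_excess (nbr_sum_deg1 _ (eqP u_leaf) uv).
Qed.

Lemma support_nbr_excess v : v \in supports -> nbr_excess v = c * e.
Proof. by move=> /support_excess vE; have := eqn v; rewrite vE; lia. Qed.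

Lemma bare_core_deg i v : v \in bare i -> deg_in core v = i.+1.
Proof.
rewrite in_bare => /and3P [v_core + /eqP <-].
rewrite in_set v_core -eqn0Ngt => /eqP no_leaf.
by rewrite -deg_excess // deg_core_leaves no_leaf addn0.
Qed.

Lemma support_core_nbr_uniq v w x : v \in supports -> deg_in core v <= 1 ->
  w \in core -> adj v w -> x \in core -> adj w x -> x = v.
Proof.
move=> v_supp v_le1 w_core vw x_core wx.
have wE : excess w = c * e.
  rewrite -(support_nbr_excess v_supp) [RHS](bigD1 w) //=.
  rewrite big1 ?addn0 // => u.
  case/andP => vu; apply: contraNeq; rewrite -lt0n => u_gt0.
  apply/eqP/(deg_in_le1_uniq v_le1) => //; rewrite in_core deg_excess //; lia.
(* The equation at [w] reads [nbr_excess w = e - c (c - 1) e (e - 1)]. *)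
have w_nbrs : nbr_excess w <= e.
  have := eqn w; have := excess_core_gt0 w_core; rewrite wE.
  by case: (c) (e) => [|c'] [|e']; nia.
apply/eqP; apply: contraT => xv.
have := @nbr_sum_ge_seq _ (@excess G) w [:: v; x].
rewrite /= !inE eq_sym xv adj_sym vw wx => /(_ isT isT).
rewrite !big_cons big_nil support_excess // -/(nbr_excess w).
by have := excess_core_gt0 x_core; lia.
Qed.

Lemma core_deg_ge2 v : v \in core -> 2 <= deg_in core v.
Proof.
move=> v_core; rewrite leqNgt; apply/negP => v_le1.
have v_supp : v \in supports.
  rewrite inE v_core /=; have := deg_core_leaves v.
  by have := excess_core_gt0 v_core; rewrite deg_excess //; lia.
pose N := [set w in core | adj v w]; have := sum_deg_in_card_gt3 sum_core_deg.
rewrite ltnNge => /negP; apply; apply: (@leq_trans #|v |: N|); last first.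
  by rewrite cardsU1; case: (_ \notin _); rewrite /N -/(deg_in core v); lia.
apply/subset_leq_card/(core_closed_subset v_core) => [|x y].
  exact: setU11.
case/setIP => _ /setU1P [->|/setIdP [x_core vx]] y_core xy.
  by rewrite in_setU1 in_set y_core xy orbT.
by rewrite (support_core_nbr_uniq v_supp v_le1 x_core vx y_core xy) setU11.
Qed.

Local Notation nb1 := (deg_in (bare 1)).
Local Notation nb2 := (deg_in (bare 2)).
Local Notation nb3 := (deg_in (bare 3)).
Local Notation nbs := (deg_in supports).

Lemma support_core_deg v : v \in supports -> 2 <= deg_in core v <= e.
Proof.
move=> v_supp; have /setIdP [v_core v_leaf] := v_supp; rewrite core_deg_ge2 //=.
by have := deg_core_leaves v; rewrite deg_excess // support_excess //; lia.
Qed.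

Lemma sum_core_branching : \sum_(v in core) (deg_in core v - 2) = 2.
Proof.
have := sum_core_deg.
rewrite (eq_bigr (fun v => deg_in core v - 2 + 2)) => [|v /core_deg_ge2 v_ge2].
  by rewrite big_split /= sum_nat_const; lia.
by rewrite subnK.
Qed.

Variant core_spec v : bool -> bool -> bool -> bool -> Prop :=
  | CoreBare1 of v \in bare 1 : core_spec v true false false false
  | CoreBare2 of v \in bare 2 : core_spec v false true false false
  | CoreBare3 of v \in bare 3 : core_spec v false false true false
  | CoreSupport of v \in supports : core_spec v false false false true.

Lemma coreP v : v \in core ->
  core_spec v (v \in bare 1) (v \in bare 2) (v \in bare 3) (v \in supports).
Proof.
move=> v_core; have := sum_core_branching; rewrite (bigD1 v) //=.
rewrite !in_bare v_core; case: (boolP (v \in supports)) => /= v_supp.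
  by constructor.
have /bare_core_deg -> : v \in bare (excess v).
  by rewrite in_bare v_core v_supp eqxx.
have := excess_core_gt0 v_core; case E: (excess v) => [|[|[|[|k]]]] //= _ _.
all: by constructor; rewrite in_bare v_core v_supp E.
Qed.

Lemma in_core_classes v : (v \in core : nat) =
  (v \in bare 1) + (v \in bare 2) + (v \in bare 3) + (v \in supports).
Proof.
have [v_core|v_core] := boolP (v \in core); first by case: (coreP v_core).
by rewrite !in_bare [v \in supports]in_set (negPf v_core).
Qed.

Lemma excess_classes v : excess v =
  (v \in bare 1) + 2 * (v \in bare 2) + 3 * (v \in bare 3)
  + e * (v \in supports).
Proof.
have [v_core|] := boolP (v \in core); last first.
  move=> v_core; rewrite !in_bare [v \in supports]in_set (negPf v_core) /=.
  by rewrite excess_leaf ?muln0 //; rewrite in_setC negbK in v_core.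
case: (coreP v_core) => [v1|v2|v3|v_supp].
- by rewrite (bare_excess v1) !muln0.
- by rewrite (bare_excess v2) !muln0.
- by rewrite (bare_excess v3) !muln0.
- by rewrite support_excess // muln1.
Qed.

Lemma core_deg_classes v : deg_in core v = nb1 v + nb2 v + nb3 v + nbs v.
Proof.
by rewrite !deg_inE -!big_split; apply: eq_bigr => u _; exact: in_core_classes.
Qed.

Lemma nbr_excess_classes v :
  nbr_excess v = nb1 v + 2 * nb2 v + 3 * nb3 v + e * nbs v.
Proof.
rewrite !deg_inE /nbr_excess /nbr_sum !big_distrr -!big_split.
by apply: eq_bigr => u _; exact: excess_classes.
Qed.

Lemma bare_equations i v : v \in bare i ->
  nb1 v + nb2 v + nb3 v + nbs v = i.+1 /\
  nb1 v + 2 * nb2 v + 3 * nb3 v + e * nbs v + i * i.+1 = c * i + e * i.+1.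
Proof.
move=> v_bare; rewrite -core_deg_classes -nbr_excess_classes.
split; first exact: bare_core_deg.
by have := eqn v; rewrite (bare_excess v_bare).
Qed.

Lemma support_equations v : v \in supports ->
  2 <= nb1 v + nb2 v + nb3 v + nbs v <= e /\
  nb1 v + 2 * nb2 v + 3 * nb3 v + e * nbs v = c * e.
Proof.
move=> v_supp; rewrite -core_deg_classes -nbr_excess_classes.
by rewrite support_core_deg // support_nbr_excess.
Qed.

Lemma sum_core_classes f : \sum_(v in core) f v =
  \sum_(v in bare 1) f v + \sum_(v in bare 2) f v + \sum_(v in bare 3) f v
  + \sum_(v in supports) f v.
Proof.
have sumE W : \sum_(v in W) f v = \sum_v (v \in W) * f v.
  by rewrite big_mkcond; apply: eq_bigr => v _; case: (v \in W); rewrite ?mul1n.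
rewrite !sumE -!big_split; apply: eq_bigr => v _ /=.
by rewrite in_core_classes !mulnDl.
Qed.

Lemma core_card_classes :
  #|core| = #|bare 1| + #|bare 2| + #|bare 3| + #|supports|.
Proof. by rewrite -!sum1_card sum_core_classes. Qed.

Lemma branching_classes :
  #|bare 2| + 2 * #|bare 3| + \sum_(v in supports) (deg_in core v - 2) = 2.
Proof.
rewrite -[RHS]sum_core_branching sum_core_classes; congr (_ + _).
have bareE i : \sum_(v in bare i) (deg_in core v - 2) = #|bare i| * (i - 1).
  by apply: eq_sum_const => v /bare_core_deg ->.
by rewrite !bareE; lia.
Qed.

(* Summing the excess equation over the core counts every core edge from both
   ends, and [branching_classes] removes the core degrees of the supports. *)
Lemma excess_balance :
  2 * e + 2 * e * #|supports|
    + 4 * #|bare 1| + 12 * #|bare 2| + 24 * #|bare 3| =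
  c * e * #|supports|
    + (c + 2 * e) * #|bare 1| + (2 * c + 4 * e) * #|bare 2|
    + (3 * c + 6 * e) * #|bare 3|.
Proof.
pose lhs v := excess v * deg_in core v + excess v * (excess v).+1.
pose rhs v := c * excess v + e * (excess v).+1.
have sum_nbr_excess :
    \sum_(v in core) nbr_excess v = \sum_(v in core) excess v * deg_in core v.
  rewrite sum_nbr_sum [RHS]big_mkcond; apply: eq_bigr => u _; case: ifPn => //.
  by rewrite in_setC negbK => /excess_leaf ->.
have : \sum_(v in core) lhs v = \sum_(v in core) rhs v.
  rewrite big_split /= -sum_nbr_excess -big_split.
  by apply: eq_bigr => v _; exact: eqn.
have bare_lhs i : \sum_(v in bare i) lhs v = #|bare i| * (2 * i * i.+1).
  apply: eq_sum_const => v v_bare.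
  by rewrite /lhs (bare_core_deg v_bare) (bare_excess v_bare); lia.
have bare_rhs i : \sum_(v in bare i) rhs v = #|bare i| * (c * i + e * i.+1).
  by apply: eq_sum_const => v /bare_excess vE; rewrite /rhs vE.
have supports_lhs : \sum_(v in supports) lhs v =
    e * (\sum_(v in supports) (deg_in core v - 2))
    + #|supports| * (2 * e + e * e.+1).
  rewrite big_distrr -sum_nat_const -big_split; apply: eq_bigr => v v_supp.
  have /andP [v_ge2 _] := support_core_deg v_supp.
  by rewrite /lhs (support_excess v_supp) -{1}(subnK v_ge2) /=; lia.
have supports_rhs :
    \sum_(v in supports) rhs v = #|supports| * (c * e + e * e.+1).
  by apply: eq_sum_const => v /support_excess vE; rewrite /rhs vE.
rewrite !sum_core_classes !bare_lhs !bare_rhs supports_lhs supports_rhs.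
by have := congr1 (muln e) branching_classes; lia.
Qed.

Lemma core_classes_gt3 : 3 < #|bare 1| + #|bare 2| + #|bare 3| + #|supports|.
Proof.
by rewrite -core_card_classes; exact/sum_deg_in_card_gt3/sum_core_deg.
Qed.

Lemma branching_classes_le2 : #|bare 2| + 2 * #|bare 3| <= 2.
Proof. by have := branching_classes; lia. Qed.

Lemma bare_card0 i : (forall v, v \in bare i -> False) -> #|bare i| = 0.
Proof. by move=> no_v; apply: eq_card0 => v; apply/negP => /no_v. Qed.

Section LeafExists.
Variable l : G.
Hypothesis l1 : deg l = 1.

Lemma supports_gt0 : 0 < #|supports|.
Proof.
have l_leaf : l \in leaves by rewrite inE l1.
have /deg_in_gt0P [v v_core lv] : 0 < deg_in core l by rewrite leaf_core_deg.
apply/card_gt0P; exists v; apply/setIdP; split=> //.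
by apply/deg_in_gt0P; exists l; rewrite // adj_sym.
Qed.

Lemma support_excess_ge2 : 2 <= e.
Proof.
have /card_gt0P [v /support_equations [/andP [ge2 le_e] _]] := supports_gt0.
exact: leq_trans le_e.
Qed.

Lemma excess_coef_gt0 : 0 < c.
Proof.
have /card_gt0P [v /support_equations [/andP [ge2 le_e]]] := supports_gt0.
by case: (c) => // nbrs0; nia.
Qed.

Lemma excess_coef_le2 : c <= 2.
Proof.
rewrite leqNgt; apply/negP => c_ge3; have e_ge2 := support_excess_ge2.
have card_gt : 3 + #|bare 3| < #|bare 1| + #|bare 2| + #|bare 3| + #|supports|.
  have [/card_gt0P [v v3]|n3_0] := ltnP 0 #|bare 3|; last first.
    by have := core_classes_gt3; lia.
  have := deg_in_lt (bare_core v3).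
  rewrite (bare_core_deg v3) core_card_classes.
  by have := branching_classes_le2; lia.
have := branching_classes_le2; have := excess_balance; move: card_gt.
move: #|bare 1| #|bare 2| #|bare 3| #|supports| => n1 n2 n3 n.
move=> card_gt balance le2.
have {balance} :
    e * n + (2 * e + 3) * n1 + (4 * e + 6) * n2 + (6 * e + 9) * n3 <=
    2 * e + 4 * n1 + 12 * n2 + 24 * n3 by nia.
have : e * (4 + n3) <= e * (n1 + n2 + n3 + n) by rewrite leq_mul2l card_gt orbT.
have : 2 * n1 <= e * n1 by rewrite leq_mul2r e_ge2 orbT.
by case: n2 n3 le2 {card_gt} => [|[|[|n2]]] [|[|n3]] //; lia.
Qed.

Section CoefOne.
Hypothesis c1 : c = 1.

Lemma coef1_support_excess_le4 : e <= 4.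
Proof.
rewrite leqNgt; apply/negP => e_ge5; have le2 := branching_classes_le2.
(* The two neighbours of a vertex of [bare 1] would have excesses with sum
   [2 e - 1], but an excess is at most [3] or equal to [e]. *)
have n1_0 : #|bare 1| = 0.
  apply: bare_card0 => v /bare_equations []; rewrite c1.
  by case: (nbs v) => [|[|[|n]]]; lia.
have /card_gt0P [v /support_equations []] := supports_gt0; rewrite c1.
have := deg_in_le (bare 1) v; have := deg_in_le (bare 2) v.
by have := deg_in_le (bare 3) v; rewrite n1_0; case: (nbs v) => [|n]; nia.
Qed.

Lemma coef1_support_excess_neq2 : e <> 2.
Proof.
move=> e2; have := branching_classes.
rewrite [#|bare 2|]bare_card0; last first.
  by move=> v /bare_equations; rewrite c1 e2; lia.
rewrite [#|bare 3|]bare_card0; last first.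
  by move=> v /bare_equations; rewrite c1 e2; lia.
rewrite big1 // => v /support_equations [+ _].
by rewrite -core_deg_classes // e2; lia.
Qed.

Lemma coef1_support_excess_neq3 : e <> 3.
Proof.
move=> e3; have le2 := branching_classes_le2; have n_gt0 := supports_gt0.
have n3_0 : #|bare 3| = 0.
  by apply: bare_card0 => v /bare_equations; rewrite c1 e3; lia.
have := excess_balance; rewrite c1 e3 n3_0 => balance.
(* The balance reads [6 + 3 #|supports| = 3 #|bare 1| + 2 #|bare 2|]. *)
have n2_0 : #|bare 2| = 0 by lia.
(* Two excesses among [1] and [3] do not sum to [5]. *)
have n1_0 : #|bare 1| = 0.
  apply: bare_card0 => v /bare_equations; rewrite c1 e3.
  by have := deg_in_le (bare 2) v; have := deg_in_le (bare 3) v; lia.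
by lia.
Qed.

Lemma coef1_support_excess_neq4 : e <> 4.
Proof.
move=> e4; have le2 := branching_classes_le2; have gt3 := core_classes_gt3.
have := excess_balance; rewrite c1 e4 => balance.
(* Two excesses sum to [7] only as [3 + 4]. *)
have bare1E v : v \in bare 1 -> nb3 v = 1.
  by move=> /bare_equations; rewrite c1 e4; lia.
have bare3E v : v \in bare 3 -> nb1 v = 3.
  move=> v3; have := bare_equations v3; rewrite c1 e4.
  by have := deg_in_le (bare 2) v; have := deg_in_lt v3; lia.
have := sum_deg_in (bare 1) (bare 3).
by rewrite (eq_sum_const bare1E) (eq_sum_const bare3E); lia.
Qed.

End CoefOne.

Lemma excess_coef_eq2 : c = 2.
Proof.
have := excess_coef_gt0; have := excess_coef_le2; have := support_excess_ge2.
have [c1|] := eqVneq c 1; last by lia.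
have := coef1_support_excess_le4 c1; have := coef1_support_excess_neq2 c1.
have := coef1_support_excess_neq3 c1; have := coef1_support_excess_neq4 c1.
by lia.
Qed.

Lemma support_excess_eq2 : e = 2.
Proof.
have c2 := excess_coef_eq2; have e_ge2 := support_excess_ge2.
have le2 := branching_classes_le2.
have := excess_balance; rewrite c2 => balance.
have [e_gt2|//] : 2 < e \/ e = 2 by lia.
have [n1_0 n2_1 n3_0] : [/\ #|bare 1| = 0, #|bare 2| = 1 & #|bare 3| = 0].
  move: #|bare 1| #|bare 2| #|bare 3| #|supports| le2 balance => n1 n2 n3 n.
  move=> le2 balance; have : n1 <= 2 by nia.
  case: n1 n2 n3 balance le2 => [|[|[|n1]]] [|[|[|n2]]] [|[|n3]] //; lia.
have /card_gt0P [v v2] : 0 < #|bare 2| by rewrite n2_1.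
have := bare_equations v2; have := deg_in_lt v2.
have := deg_in_le (bare 1) v; have := deg_in_le (bare 3) v.
by rewrite c2 n1_0 n2_1 n3_0; nia.
Qed.

End LeafExists.

End ExcessEquation.
End Core.

(** * The extremal graphs *)

Section ThetaDegrees.
Variable n : nat.
Local Notation H := (theta_pendant n.+2).
Implicit Types x y : H.

Definition theta_path (i : nat) : H := inl (inl (inord i)).
Definition theta_mid (c : bool) : H := inl (inr c).
Definition theta_leaf (i : nat) : H := inr (inord i).

Definition theta_nbrs x : seq H :=
  match x with
  | inl (inl i) =>
      if i == 0 :> nat then [:: theta_path 1; theta_mid false; theta_mid true]
      else if i == n.+2 :> nat then
        [:: theta_path n.+1; theta_mid false; theta_mid true]
      else [:: theta_path i.-1; theta_path i.+1; theta_leaf i.-1]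
  | inl (inr _) => [:: theta_path 0; theta_path n.+2]
  | inr j => [:: theta_path j.+1]
  end.

Lemma eq_theta_path (i : 'I_n.+3) j : j < n.+3 ->
  (inl (inl i) == theta_path j :> H) = (i == j :> nat).
Proof.
move=> lt_j; apply/eqP/eqP => [[->]|ij]; first by rewrite inordK.
by congr (inl (inl _)); apply: val_inj; rewrite /= inordK.
Qed.

Lemma eq_theta_leaf (i : 'I_n.+1) j : j < n.+1 ->
  (inr i == theta_leaf j :> H) = (i == j :> nat).
Proof.
move=> lt_j; apply/eqP/eqP => [[->]|ij]; first by rewrite inordK.
by congr inr; apply: val_inj; rewrite /= inordK.
Qed.

Lemma mem_theta_nbrs x y : (y \in theta_nbrs x) = adj x y.
Proof.
have midE (c c' : bool) : (inl (inr c) == theta_mid c') = (c == c') by [].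
have path_midE (i : 'I_n.+3) c : (inl (inl i) == theta_mid c) = false by [].
have leaf_midE (j : 'I_n.+1) c : (inr j == theta_mid c) = false by [].
have inl_leafE z j : (inl z == theta_leaf j :> H) = false by [].
rewrite /= /theta_adj; case: x => [[i|c]|j]; rewrite /theta_nbrs; last first.
- have /= lt_j := ltn_ord j.
  by case: y => [[i|c]|j'] //=; rewrite !inE ?eq_theta_path //; lia.
- by case: y => [[i|c']|j'] //=; rewrite !inE ?eq_theta_path //; lia.
have lt_i := ltn_ord i; case: eqP => i0; [|case: eqP => ik];
  case: y => [[i'|c]|j'] /=; rewrite !inE ?eq_theta_path ?eq_theta_leaf //=;
  rewrite ?midE ?path_midE ?leaf_midE ?inl_leafE;
  by [have := ltn_ord i'; lia|case: c; lia|have /= := ltn_ord j'; lia].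
Qed.

Lemma uniq_theta_nbrs x : uniq (theta_nbrs x).
Proof.
case: x => [[i|c]|j] //; rewrite /theta_nbrs; last first.
  by rewrite /= !inE eq_theta_path // inordK.
have lt_i := ltn_ord i; case: eqP => // i0; case: eqP => //= ik.
by rewrite !inE orbF andbT !eq_theta_path ?inordK //; lia.
Qed.

Lemma nbr_sum_theta (f : H -> nat) x :
  nbr_sum f x = \sum_(y <- theta_nbrs x) f y.
Proof.
rewrite [RHS]big_uniq ?uniq_theta_nbrs //.
by apply: eq_bigl => y; rewrite mem_theta_nbrs.
Qed.

Definition theta_degree x : nat :=
  match x with inl (inl _) => 3 | inl (inr _) => 2 | inr _ => 1 end.

Lemma deg_theta x : deg x = theta_degree x.
Proof.
rewrite degE nbr_sum_theta sum1_size.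
by case: x => [[i|c]|j] //=; case: eqP => // _; case: eqP.
Qed.

Lemma theta_degree_equation (R : rcfType) :
  degree_equation H (6 : R)%R (- 2)%R.
Proof.
move=> x; have : deg x ^ 2 + nbr_sum (@deg H) x + 2 = 6 * deg x.
  rewrite (eq_nbr_sum (fun y _ => deg_theta y)) deg_theta nbr_sum_theta.
  by case: x => [[i|c]|j] /=; do ?case: eqP => _; rewrite !big_cons big_nil.
move/(congr1 (fun k => k%:R : R)%R).
by rewrite natrM !natrD natrX natr_sum => ?; lra.
Qed.

End ThetaDegrees.

Section ThetaRecognition.
Variables (G : sgraph) (n : nat) (g leaf : nat -> G) (mid : bool -> G).
Hypothesis connG : connected_graph G.
Hypothesis deg_path : forall i, i < n.+3 -> deg (g i) = 3.
Hypothesis inj_path : forall i j, i < n.+3 -> j < n.+3 -> g i = g j -> i = j.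
Hypothesis adj_path : forall i, i < n.+2 -> adj (g i) (g i.+1).
Hypotheses (deg_mid : forall c, deg (mid c) = 2) (inj_mid : injective mid).
Hypothesis adj_mid : forall c, adj (g 0) (mid c) /\ adj (g n.+2) (mid c).
Hypothesis leafP :
  forall i, i < n.+1 -> deg (leaf i) = 1 /\ adj (g i.+1) (leaf i).

Let h (x : theta_pendant n.+2) : G := match x with
  | inl (inl i) => g i
  | inl (inr c) => mid c
  | inr j => leaf j
  end.

Lemma theta_embedding_deg x : deg (h x) = deg x.
Proof.
rewrite deg_theta; case: x => [[i|c]|j] /=; first exact/deg_path/ltn_ord.
  exact: deg_mid.
by have [] := leafP (ltn_ord j).
Qed.

(* Vertices of different kinds have different degrees. *)
Lemma theta_embedding_inj : injective h.
Proof.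
move=> x y hxy; have := theta_embedding_deg x.
rewrite hxy theta_embedding_deg !deg_theta.
case: x y hxy => [[i|c]|j] [[i'|c']|j'] //= hxy _.
- congr (inl (inl _)); apply: val_inj.
  exact: inj_path (ltn_ord i) (ltn_ord i') hxy.
- by congr (inl (inr _)); exact: inj_mid.
have [leaf1 adj_leaf] := leafP (ltn_ord j).
have [_ adj_leaf'] := leafP (ltn_ord j'); rewrite -hxy in adj_leaf'.
rewrite adj_sym in adj_leaf; rewrite adj_sym in adj_leaf'.
have lt_S (k : 'I_n.+1) : k.+1 < n.+3 by rewrite ltnS leqW ?ltn_ord.
have [jj'] := inj_path (lt_S j) (lt_S j') (deg1_uniq leaf1 adj_leaf adj_leaf').
by congr inr; apply: val_inj.
Qed.

Lemma theta_embedding_hom x y : adj x y -> adj (h x) (h y).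
Proof.
have arc_hom x' y' : theta_arc x' y' -> adj (h x') (h y').
  case: x' y' => [[i|c]|j] [[i'|c']|j'] //= => [/eqP i'E|i_end|/eqP ->].
  - by rewrite -i'E adj_path // -ltnS i'E ltn_ord.
  - by have [mid0 midn] := adj_mid c'; case/orP: i_end => /eqP ->.
  - by have [] := leafP (ltn_ord j').
by case/orP => /arc_hom //; rewrite adj_sym.
Qed.

Lemma theta_pendant_isomorphic : isomorphic G (theta_pendant n.+2).
Proof.
exact: (injective_deg_hom_isomorphic (theta_mid n true) connG
  theta_embedding_inj theta_embedding_hom theta_embedding_deg).
Qed.

End ThetaRecognition.

Section Extremal.
Variables (G : sgraph) (l : G).
Hypotheses (bicG : bicyclic G) (l1 : deg l = 1).
Hypothesis eqn : excess_equation G 2 2.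
Implicit Types (u v : G).

Local Notation bare := (@bare G).
Local Notation supports := (supports G).
Local Notation nb1 := (deg_in (bare 1)).
Local Notation nb2 := (deg_in (bare 2)).
Local Notation nbs := (deg_in supports).

Definition spine : {set G} := bare 2 :|: supports.

Lemma card_bare3 : #|bare 3| = 0.
Proof. by apply: bare_card0 => v /(bare_equations bicG eqn); lia. Qed.

Lemma no_bare3_nbr v : deg_in (bare 3) v = 0.
Proof. by have := deg_in_le (bare 3) v; rewrite card_bare3 leqn0 => /eqP. Qed.

Lemma card_bare2 : #|bare 2| = 2.
Proof.
have := branching_classes bicG eqn.
rewrite card_bare3 big1 => [|v /(support_core_deg bicG eqn) /andP [_ v_le2]].
  by lia.
by apply/eqP; rewrite subn_eq0.
Qed.

Lemma card_bare1 : #|bare 1| = 2.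
Proof.
by have := excess_balance bicG eqn; rewrite card_bare3 card_bare2; lia.
Qed.

Lemma support_profile v : v \in supports -> nb1 v = 0 /\ nb2 v + nbs v = 2.
Proof. by move/(support_equations bicG eqn); rewrite no_bare3_nbr; lia. Qed.

Lemma bare2_profile v : v \in bare 2 -> nb1 v = 2 /\ nb2 v + nbs v = 1.
Proof. by move/(bare_equations bicG eqn); rewrite no_bare3_nbr; lia. Qed.

Lemma bare1_no_support v : v \in bare 1 -> nbs v = 0.
Proof.
move=> v1; apply/eqP; rewrite -leqn0 leqNgt.
apply/negP => /deg_in_gt0P [u u_supp]; rewrite adj_sym => uv.
have /deg_in_gt0P : exists2 w, w \in bare 1 & adj u w by exists v.
by have [-> _] := support_profile u_supp.
Qed.

Lemma bare2_bare1_adj u v : u \in bare 2 -> v \in bare 1 -> adj u v.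
Proof.
by case/bare2_profile => uE _; apply: deg_in_full; rewrite uE card_bare1.
Qed.

Lemma bare2_nonadjacent u v : u \in bare 2 -> v \in bare 2 -> ~~ adj u v.
Proof.
move=> u2 v2; apply/negP => uv.
have uvE : bare 2 = [set u; v].
  apply/esym/eqP; rewrite eqEcard card_bare2 cards2 subUset !sub1set u2 v2.
  by case: eqP uv => // ->; rewrite adj_irrefl.
have /card_gt0P [w w_supp] := supports_gt0 bicG l1.
have /setIdP [w_core _] := w_supp.
suff /subsetP/(_ w w_core) : core G \subset bare 1 :|: bare 2.
  by rewrite in_setU !in_bare w_supp !andbF.
apply: (core_closed_subset bicG (bare_core u2)) => [|x y].
  by rewrite in_setU u2 orbT.
case/setIP => _ x_bare y_core xy.
have [y_supp|y_supp] := boolP (y \in supports); last first.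
  have := in_core_classes bicG eqn y; rewrite y_core (negPf y_supp) in_setU.
  have /card0_eq/(_ y) -> := card_bare3.
  by case: (y \in bare 1); case: (y \in bare 2).
have : 0 < nbs x by apply/deg_in_gt0P; exists y.
case/setUP: x_bare => [/bare1_no_support -> //|x2].
suff /deg_in_gt0P : exists2 z, z \in bare 2 & adj x z.
  by have [_] := bare2_profile x2; lia.
move: (x2); rewrite uvE => /set2P [] ->; first by exists v; rewrite // set22.
by exists u; rewrite ?set21 // adj_sym.
Qed.

Lemma spine_deg v : v \in spine -> deg v = 3.
Proof.
rewrite deg_excess // => /setUP [/bare_excess -> //|].
by move/(support_excess eqn) ->.
Qed.

Lemma deg_in_spine v : deg_in spine v = nb2 v + nbs v.
Proof.
rewrite !deg_inE -big_split; apply: eq_bigr => u _.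
rewrite in_setU in_bare; case: (u \in supports) => /=.
  by rewrite andbF.
by rewrite orbF addn0.
Qed.

Lemma spine_connect u v :
  bare 2 = [set u; v] -> connect (@adj (restrict spine)) u v.
Proof.
move=> bare2E; apply: odd_deg_connect => [|w wu wv]; rewrite deg_restrict.
  have u2 : u \in bare 2 by rewrite bare2E set21.
  by rewrite in_setU u2 /= deg_in_spine; have [_ ->] := bare2_profile u2.
case: ifP => //; rewrite in_setU bare2E in_set2 (negPf wu) (negPf wv) /=.
by rewrite deg_in_spine => /support_profile [_ ->].
Qed.

Lemma spine_path u v : u != v -> bare 2 = [set u; v] ->
  exists n (g : nat -> G), [/\ g 0 = u, g n.+2 = v,
    forall i, i < n.+3 -> g i \in spine,
    forall i, i < n.+2 -> adj (g i) (g i.+1) &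
    forall i j, i < n.+3 -> j < n.+3 -> g i = g j -> i = j].
Proof.
move=> uv bare2E; have /connectP [q0 q0_path vE] := spine_connect bare2E.
case/shortenP: q0_path vE => q q_path uniq_q _ vE.
have u2 : u \in bare 2 by rewrite bare2E set21.
have v2 : v \in bare 2 by rewrite bare2E set22.
have adj_q i : i < size q ->
    nth u q i \in spine /\ adj (nth u (u :: q) i) (nth u q i).
  by move=> lt_i; have /(pathP u)/(_ i lt_i)/and3P [] := q_path.
have in_spine x : x \in u :: q -> x \in spine.
  rewrite inE => /predU1P [->|/(nthP u) [i /adj_q [q_i _] <-]] //.
  by rewrite in_setU u2.
case: q {q_path} => [|x [|y q]] in uniq_q vE in_spine adj_q *.
- by rewrite vE eqxx in uv.
- have [//|_] := adj_q 0; have := bare2_nonadjacent u2 v2.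
  by rewrite vE /= => /negPf ->.
exists (size q), (nth u [:: u, x, y & q]); split=> //.
- by rewrite vE -nth_last.
- by move=> i lt_i; exact/in_spine/mem_nth.
- by move=> i /adj_q [].
- by move=> i j lt_i lt_j /eqP; rewrite nth_uniq // => /eqP.
Qed.

Lemma extremal_isomorphic : exists2 k, 2 <= k & isomorphic G (theta_pendant k).
Proof.
have /cards2P [u [v [uv bare2E]]] : #|bare 2| == 2 by rewrite card_bare2.
have /cards2P [q1 [q2 [q12 bare1E]]] : #|bare 1| == 2 by rewrite card_bare1.
have [n [g [g0 gn g_spine g_adj g_inj]]] := spine_path uv bare2E.
have leaf_ex x : exists y, x \in supports -> deg y = 1 /\ adj x y.
  have [|x_supp] := boolP (x \in supports); last by exists x.
  case/setIdP => _ /deg_in_gt0P [y + xy]; rewrite inE => /eqP y1.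
  by exists y.
have [leaf leafP] := fin_all_exists leaf_ex.
exists n.+2 => //.
pose mid c := if c then q2 else q1.
have mid_bare1 c : mid c \in bare 1.
  by rewrite bare1E; case: c; rewrite ?set21 ?set22.
pose path_leaf i := leaf (g i.+1).
apply: (@theta_pendant_isomorphic G n g path_leaf mid bicG.1) => //.
- by move=> i /g_spine/spine_deg.
- by move=> c; rewrite deg_excess // (bare_excess (mid_bare1 c)).
- by move=> [] [] //= q12E; rewrite q12E eqxx in q12.
- by move=> c; rewrite g0 gn !bare2_bare1_adj // bare2E ?set21 ?set22.
move=> i lt_i; apply: leafP.
have lt_i3 : i.+1 < n.+3 by rewrite ltnS leqW.
have := g_spine _ lt_i3; rewrite in_setU bare2E in_set2 -g0 -gn => /orP [|//].
by case/orP => /eqP /g_inj -/(_ lt_i3); lia.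
Qed.

End Extremal.

Lemma excess_equation_isomorphic (G : sgraph) (c e : nat) (l : G) :
    bicyclic G -> deg l = 1 -> excess_equation G c e ->
  exists2 k, 2 <= k & isomorphic G (theta_pendant k).
Proof.
move=> bicG l1 eqn; apply: (extremal_isomorphic bicG l1).
by rewrite -{1}(excess_coef_eq2 bicG eqn l1) -(support_excess_eq2 bicG eqn l1).
Qed.

Theorem theorem1 (R : rcfType) (G : sgraph) (hG : bicyclic G)
    (hdelta : min_deg G = 1) :
  exactly_two_main_signless_eigenvalues R G <->
  exists2 k : nat, 2 <= k & isomorphic G (theta_pendant k).
Proof.
have [l l1] := bicyclic_leaf hG hdelta.
have [r lr] : exists r, adj l r.
  by have /card_gt0P [r] : 0 < deg l; rewrite ?l1 // inE; exists r.
have deg_lr : deg l != deg r.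
  rewrite l1 eq_sym; apply: contraL lr => /eqP.
  exact: bicyclic_leaves_nonadjacent.
apply: iff_trans (exactly_two_main_signless_eigenvaluesP R deg_lr) _.
split=> [[a [b [_ degE]]]|[[|[|n]] // _ isoG]].
  have [c eqn] := excess_equation_exists hG l1 lr degE.
  exact: excess_equation_isomorphic hG l1 eqn.
exists 6%R, (- 2)%R; split; first by lra.
exact: degree_equation_isomorphic isoG (@theta_degree_equation n R).
Qed.
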